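(* Let $P$ be a finite bounded poset with a left modular maximal chain $M$. Then $P$ has an interpolating EL-labelling with $M$ as its increasing maximal chain (i.e. $M$ is the unique increasing chain from $\hat{0}$ to $\hat{1}$).
   Context: A poset is bounded if it has a unique minimum $\hat 0$ and a unique maximum $\hat 1$; all posets are finite. An edge-labelling of $P$ is a map $\gamma$ from the covering relations $y\lessdot z$ of $P$ to $\mathbb{Z}$. It is an EL-labelling if for every $y<z$ in $P$: (i) there is a unique unrefinable chain $y=w_0\lessdot w_1\lessdot\cdots\lessdot w_r=z$ with $\gamma(w_0,w_1)\le\gamma(w_1,w_2)\le\cdots\le\gamma(w_{r-1},w_r)$ (the increasing chain from $y$ to $z$), and (ii) its label sequence, read bottom to top, lexicographically precedes that of every other unrefinable chain from $y$ to $z$. An EL-labelling $\gamma$ is interpolating if for every $y\lessdot u\lessdot z$, either $\gamma(y,u)<\gamma(u,z)$, or the increasing chain $y=w_0\lessdot\cdots\lessdot w_r=z$ has strictly increasing labels with $\gamma(w_0,w_1)=\gamma(u,z)$ and $\gamma(w_{r-1},w_r)=\gamma(y,u)$. For $x,y\in P$, $x\vee y$ (resp. $x\wedge y$) denotes the least common upper bound (resp. greatest common lower bound) if it exists. For $w,z\ge y$, $w\wedge_y z$ denotes the greatest element of $\{u\in P: y\le u,\ u\le w,\ u\le z\}$ if it exists; for $w,y\le z$, $w\vee^z y$ denotes the least element of $\{u\in P: u\ge w,\ u\ge y,\ u\le z\}$ if it exists. An element $x\in P$ is viable if for all $y\le z$ in $P$ both $(x\vee y)\wedge_y z$ and $(x\wedge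 z)\vee^z y$ are well-defined (exist); a viable $x$ is left modular if moreover $(x\vee y)\wedge_y z=(x\wedge z)\vee^z y$ for all $y\le z$. A maximal chain (maximal under inclusion) is left modular if each of its elements is viable and left modular. *)

(* Defs.v *)
From mathcomp Require Import all_boot all_order all_algebra.

Set Implicit Arguments.
Unset Strict Implicit.
Unset Printing Implicit Defensive.

Import Order.TTheory.
Local Open Scope order_scope.

Definition least d (P : porderType d) (A : pred P) (m : P) : Prop :=
  A m /\ forall u, A u -> m <= u.

Definition greatest d (P : porderType d) (A : pred P) (m : P) : Prop :=
  A m /\ forall u, A u -> u <= m.

Definition is_join d (P : porderType d) (x y j : P) : Prop :=
  least [pred u | (x <= u) && (y <= u)] j.

Definition is_meet d (P : porderType d) (x y m : P) : Prop :=
  greatest [pred u | (u <= x) && (u <= y)] m.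

(* [is_meet_above y w z m] is m = w /\_y z; it is only used for w, z >= y. *)
Definition is_meet_above d (P : porderType d) (y w z m : P) : Prop :=
  greatest [pred u | [&& y <= u, u <= w & u <= z]] m.

(* [is_join_below z w y j] is j = w \/^z y; it is only used for w, y <= z. *)
Definition is_join_below d (P : porderType d) (z w y j : P) : Prop :=
  least [pred u | [&& w <= u, y <= u & u <= z]] j.

(* [left_expr x y z m] is m = (x \/ y) /\_y z, including the existence of both
   operations; [right_expr x y z m] is m = (x /\ z) \/^z y. *)
Definition left_expr d (P : porderType d) (x y z m : P) : Prop :=
  exists2 j, is_join x y j & is_meet_above y j z m.

Definition right_expr d (P : porderType d) (x y z m : P) : Prop :=
  exists2 k, is_meet x z k & is_join_below z k y m.

Definition viable d (P : porderType d) (x : P) : Prop :=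
  forall y z, y <= z ->
    (exists m, left_expr x y z m) /\ (exists m, right_expr x y z m).

(* The values of both expressions are unique by antisymmetry, so quantifying
   over all of them expresses the equality of the two terms. *)
Definition left_modular d (P : porderType d) (x : P) : Prop :=
  viable x /\
  forall y z, y <= z ->
    forall m m', left_expr x y z m -> right_expr x y z m' -> m = m'.

Definition is_chain d (P : finPOrderType d) (C : {set P}) : bool :=
  [forall x in C, forall y in C, x >=< y].

Definition maximal_chain d (P : finPOrderType d) (M : {set P}) : bool :=
  maxset (@is_chain d P) M.

Definition covers d (P : finPOrderType d) (y z : P) : bool :=
  (y < z) && [forall u : P, ~~ ((y < u) && (u < z))].

(* The chain y = w_0 < w_1 < ... < w_r = z is encoded by y, z and the sequence
   c = [:: w_1; ...; w_r], as for [path]. *)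
Definition unrefinable_chain d (P : finPOrderType d) (y z : P) (c : seq P) :
    bool :=
  path (@covers d P) y c && (last y c == z).

(* A labelling is a total function on pairs; only its values on covering pairs
   are ever used. *)
Definition edge_labelling d (P : finPOrderType d) := P -> P -> int.

Definition labels d (P : finPOrderType d) (gamma : edge_labelling P) (y : P)
    (c : seq P) : seq int :=
  pairmap gamma y c.

Definition increasing_chain d (P : finPOrderType d) (gamma : edge_labelling P)
    (y z : P) (c : seq P) : bool :=
  unrefinable_chain y z c && sorted <=%O (labels gamma y c).

(* A proper prefix is lexicographically smaller. *)
Definition lex_precedes (s t : seq int) : bool :=
  (s : seqlexi int) < (t : seqlexi int).

Definition EL_labelling d (P : finPOrderType d) (gamma : edge_labelling P) :
    Prop :=
  forall y z : P, y < z ->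
    exists c, unique (increasing_chain gamma y z) c /\
      forall c', unrefinable_chain y z c' -> c' <> c ->
        lex_precedes (labels gamma y c) (labels gamma y c').

(* The default 0 is never used: a chain from y to z > y has a label. *)
Definition interpolating d (P : finPOrderType d) (gamma : edge_labelling P) :
    Prop :=
  forall y u z : P, covers y u -> covers u z ->
    gamma y u < gamma u z \/
    exists c, [/\ increasing_chain gamma y z c,
                  sorted <%O (labels gamma y c),
                  head 0%R (labels gamma y c) = gamma u z &
                  last 0%R (labels gamma y c) = gamma y u].

(* Main.v *)
(** Label a cover [y <. z] by the number of [x] in [M] with [x /\ z <= y]; left
    modularity makes this the number of [x] in [M] with [~ z <= x \/ y].  For an
    arbitrary interval [y <= z] these two counts bound all the labels of covers
    inside it, from below and from above, and both are attained on every
    unrefinable chain from [y] to [z].  If [q] is the least element of [M] with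
    [~ q /\ z <= y], then [(q \/ y) /\_y z] is the only cover of [y] in the
    interval carrying the least label, and all labels above it are larger: hence
    a unique increasing chain, strictly increasing and lexicographically first.
    Its end labels are the two bounds, which on [y <. u <. z] must be the two
    labels of that chain; this gives the interpolation property. *)

Require Import Defs.
From mathcomp Require Import all_boot all_order all_algebra.
Local Open Scope order_scope.

Set Implicit Arguments.
Unset Strict Implicit.
Unset Printing Implicit Defensive.
Import Order.TTheory.

(** * Projections of left modular elements to intervals *)

Section MeetJoinInequalities.
Variables (d : Order.disp_t) (P : finPOrderType d).
Implicit Types x y z u v w : P.

(* [meet_le x z y] is x /\ z <= y and [le_join z x y] is z <= x \/ y, phrased so
   as to make sense even when the meet or the join does not exist. *)
Definition meet_le x z y := [forall u : P, (u <= x) && (u <= z) ==> (u <= y)].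
Definition le_join z x y := [forall u : P, (x <= u) && (y <= u) ==> (z <= u)].

Lemma meet_leP x z y :
  reflect (forall u, u <= x -> u <= z -> u <= y) (meet_le x z y).
Proof.
apply: (iffP forallP) => h u; last by apply/implyP => /andP[]; apply: h.
by move=> ux uz; move: (h u); rewrite ux uz.
Qed.

Lemma le_joinP z x y :
  reflect (forall u, x <= u -> y <= u -> z <= u) (le_join z x y).
Proof.
apply: (iffP forallP) => h u; last by apply/implyP => /andP[]; apply: h.
by move=> ux uz; move: (h u); rewrite ux uz.
Qed.

Lemma left_modular_join x y : left_modular x -> exists j, is_join x y j.
Proof. by case=> /(_ y y (lexx _)) [[m [j hj _]] _] _; exists j. Qed.

Lemma left_modular_meet x z : left_modular x -> exists k, is_meet x z k.
Proof. by case=> /(_ z z (lexx _)) [_ [m [k hk _]]] _; exists k. Qed.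

(** The common value of the two expressions for [x] is at once the greatest element of $[y,z]$ below
    $x \vee y$ and the least one above $x \wedge z$; only these two extremal properties are used
    later. *)
Lemma left_modular_projection x y z : left_modular x -> y <= z ->
  exists m, [/\ y <= m <= z, meet_le x z m, le_join m x y,
    forall u, y <= u <= z -> le_join u x y -> u <= m &
    forall u, y <= u <= z -> meet_le x z u -> m <= u].
Proof.
move=> [vx lmx] yz; have [[m hl] [m' hr]] := vx y z yz.
have mm' := lmx y z yz m m' hl hr; subst m'; exists m.
case: hl => j [/= /andP[xj yj] hj] [/= /and3P[ym mj mz] hm].
case: hr => k [/= /andP[kx kz] hk] [/= /and3P[km _ _] hm'].
split; first by rewrite ym.
- by apply/meet_leP => u ux uz; apply: le_trans km; apply: hk; rewrite ux.
- by apply/le_joinP => u xu yu; apply: (le_trans mj); apply: hj; rewrite xu.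
- move=> u /andP[yu uz] /le_joinP uxy; apply: hm; rewrite yu uz.
  by rewrite (uxy j).
- move=> u /andP[yu uz] /meet_leP uxy; apply: hm'; rewrite yu uz.
  by rewrite (uxy k).
Qed.

Lemma covers_lt y z : covers y z -> y < z.
Proof. by case/andP. Qed.

Lemma covers_between y z u : covers y z -> y <= u -> u <= z -> u = y \/ u = z.
Proof.
case/andP => _ /forallP/(_ u) nu; rewrite !le_eqVlt.
case/predU1P => [->|yu]; first by left.
by case/predU1P => [->|uz]; [right | rewrite yu uz in nu].
Qed.

(** The projection of [x] to a cover is one of its two ends: [y] exactly when the meet inequality
    holds, [z] exactly when the join inequality does. *)
Lemma covers_meet_le_join x y z : left_modular x -> covers y z ->
  meet_le x z y = ~~ le_join z x y.
Proof.
move=> lmx cyz; have ltyz := covers_lt cyz; have yz := ltW ltyz.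
have [m [/andP[ym mz] hA hB hC hD]] := left_modular_projection lmx yz.
have [em|em] := covers_between cyz ym mz; subst m.
  rewrite hA; apply/esym/negP => /hC; rewrite lexx yz => /(_ isT).
  by rewrite lt_geF.
rewrite hB /=; apply/negP => /hD; rewrite lexx yz => /(_ isT).
by rewrite lt_geF.
Qed.

(* With v strictly between y and the projection u of q, left modularity of q shows
   that p \/ v is p \/ y or q \/ y; that of p excludes each of the two cases. *)
Lemma covers_projection p q y z : left_modular p -> left_modular q ->
    covers p q -> y <= z -> meet_le p z y -> ~~ meet_le q z y ->
  exists u, [/\ covers y u, u <= z, meet_le q z u, le_join u q y &
    forall w, y <= w <= z -> le_join w q y -> w <= u].
Proof.
move=> lmp lmq cpq yz pzy qzy; have pq := ltW (covers_lt cpq).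
have [u [/andP[yu uz] qzu uqy maxu _]] := left_modular_projection lmq yz.
exists u; split=> //; apply/andP; split.
  by rewrite lt_neqAle yu andbT; apply: contraNneq qzy => ->.
apply/forallP => v; apply/negP => /andP[yv vu].
have vz : v <= z := le_trans (ltW vu) uz.
have [j [/= /andP[pj vj] minj]] := left_modular_join v lmp.
have yj : y <= j := le_trans (ltW yv) vj.
(* If $q \le p \vee v$, the projection of [p] to $[v,z]$ is at most [v], since $p \wedge z \le y$,
   yet it lies above [u]. *)
have [qj|qj] := boolP (q <= j).
  have [m [_ _ _ hC hD]] := left_modular_projection lmp vz.
  have mv : m <= v.
    apply: hD; first by rewrite lexx.
    apply/meet_leP => t tp tz; apply: le_trans (ltW yv).
    exact: (meet_leP _ _ _ pzy).
  have um : u <= m.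
    apply: hC; first by rewrite (ltW vu).
    apply/le_joinP => t pt vt; apply: (le_joinP _ _ _ uqy).
      by apply: le_trans qj _; apply: minj; rewrite pt.
    exact: le_trans (ltW yv) vt.
  by move: (lt_le_trans vu (le_trans um mv)); rewrite ltxx.
(* Otherwise $q \wedge j = p$, because [q] covers [p]. The projection of [q] to $[y,j]$ is then
   below $p \vee y$, while $j \le q \vee y$ makes it equal to [j]. *)
have [m [_ _ _ hC hD]] := left_modular_projection lmq yj.
have jm : j <= m.
  apply: hC; first by rewrite yj lexx.
  apply/le_joinP => t qt yt; apply: minj; rewrite /= (le_trans pq qt) /=.
  by apply: (le_trans (ltW vu)); apply: (le_joinP _ _ _ uqy).
have [i [/= /andP[pi yi] mini]] := left_modular_join y lmp.
have mi : m <= i.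
  apply: hD; first by rewrite yi; apply: mini; rewrite pj.
  have [k [/= /andP[kq kj] maxk]] := left_modular_meet j lmq.
  have pk : p <= k by apply: maxk; rewrite pq.
  have [ek|ek] := covers_between cpq pk kq; subst k; last by rewrite kj in qj.
  by apply/meet_leP => t tq tj; apply: le_trans pi; apply: maxk; rewrite tq.
(* Now $v \le p \vee y$, so [v] lies below the projection of [p] to $[y,z]$, which is at most
   [y]. *)
have [m0 [_ _ _ hC0 hD0]] := left_modular_projection lmp yz.
have m0y : m0 <= y by apply: hD0; rewrite ?lexx.
have vm0 : v <= m0.
  apply: hC0; first by rewrite (ltW yv).
  apply/le_joinP => t pt yt; apply: (le_trans vj); apply: (le_trans jm).
  by apply: (le_trans mi); apply: mini; rewrite pt.
by move: (lt_le_trans yv (le_trans vm0 m0y)); rewrite ltxx.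
Qed.

End MeetJoinInequalities.

(** * The maximal chain and its initial segments *)

Section Labelling.
Variables (d : Order.disp_t) (P : finTBPOrderType d) (M : {set P}).
Hypothesis maxM : maximal_chain M.
Hypothesis lmM : forall x : P, x \in M -> left_modular x.
Implicit Types x y z u v w : P.

(* As [M] is a chain, sets of this form are initial segments of it, so comparing
   their cardinals amounts to comparing them for inclusion. *)
Definition low y z := [set x in M | meet_le x z y].
Definition high y z := [set x in M | ~~ le_join z x y].
(* On intervals that are not covers this is the least label of the interval. *)
Definition modular_label y z : int := Posz #|low y z|.
Definition high_label y z : int := Posz #|high y z|.

Lemma chain_comparable x y : x \in M -> y \in M -> x >=< y.
Proof.
have /maxsetP[/forallP chM _] := maxM => xM yM.
by have := chM x; rewrite xM => /forallP/(_ y); rewrite yM.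
Qed.

Lemma mem_maximal_chain x : (forall y, y \in M -> x >=< y) -> x \in M.
Proof.
have /maxsetP[/forallP chM maxM'] := maxM => hx.
suff <- : x |: M = M by rewrite setU11.
apply: maxM'; last exact: subsetUr.
apply/forallP => a; apply/implyP => /setU1P[->|aM].
  by apply/forallP => b; apply/implyP => /setU1P[->|/hx //]; exact: comparablexx.
apply/forallP => b; apply/implyP => /setU1P[->|bM].
  by rewrite comparable_sym hx.
exact: chain_comparable.
Qed.

Lemma bot_chain : \bot \in M.
Proof. by apply: mem_maximal_chain => y _; apply: le_comparable; exact: le0x. Qed.

Lemma top_chain : \top \in M.
Proof. by apply: mem_maximal_chain => y _; apply: ge_comparable; exact: lex1. Qed.

(** The size of the principal ideal serves as a rank function, so that extremal elements of subsets
    of [M] can be found by optimising a number. *)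
Lemma card_below_lt x y : x < y ->
  (#|[set t | (t <= x)%O]| < #|[set t | (t <= y)%O]|)%N.
Proof.
move=> xy; apply/proper_card/properP; split.
  by apply/subsetP => t; rewrite !inE => /le_trans/(_ (ltW xy)).
by exists y; rewrite inE ?lexx // lt_geF.
Qed.

Lemma chain_min (A : {set P}) : A \subset M -> A != set0 ->
  exists2 q, q \in A & forall x, x \in A -> q <= x.
Proof.
move=> /subsetP AM /set0Pn[a aA].
have [q qA minq] := arg_minnP (fun x => #|[set t | t <= x]|) aA.
exists q => // x xA; rewrite comparable_leNgt ?chain_comparable ?AM //.
by apply/negP => /card_below_lt; rewrite ltnNge minq.
Qed.

Lemma chain_max (A : {set P}) : A \subset M -> A != set0 ->
  exists2 q, q \in A & forall x, x \in A -> x <= q.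
Proof.
move=> /subsetP AM /set0Pn[a aA].
have [q qA maxq] := arg_maxnP (fun x => #|[set t | t <= x]|) aA.
exists q => // x xA; rewrite comparable_leNgt ?chain_comparable ?AM //.
by apply/negP => /card_below_lt; rewrite ltnNge (maxq x xA : (_ <= _)%N).
Qed.

Lemma chain_pred q : q \in M -> q != \bot ->
  exists p, [/\ p \in M, covers p q & forall x, x \in M -> x < q -> x <= p].
Proof.
move=> qM q0; pose A := [set x in M | x < q].
have AM : A \subset M by apply/subsetP => x; rewrite inE => /andP[].
have An0 : A != set0.
  by apply/set0Pn; exists \bot; rewrite inE bot_chain lt0x q0.
have [p] := chain_max AM An0; rewrite inE => /andP[pM pq] maxA.
have maxp x : x \in M -> x < q -> x <= p.
  by move=> xM xq; apply: maxA; rewrite inE xM.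
exists p; split=> //; rewrite /covers pq; apply/forallP => u.
apply/negP => /andP[pu uq].
have uM : u \in M.
  apply: mem_maximal_chain => y yM.
  have /orP[qy|] := chain_comparable qM yM.
    by apply: le_comparable; exact: le_trans (ltW uq) qy.
  rewrite le_eqVlt => /predU1P[->|yq]; first exact: lt_comparable.
  by apply: ge_comparable; apply: le_trans (maxp _ yM yq) (ltW pu).
by have := lt_le_trans pu (maxp u uM uq); rewrite ltxx.
Qed.

(** * Labels of covers and of intervals *)

Lemma low_covers y z : covers y z -> low y z = high y z.
Proof.
move=> cyz; apply/setP => x; rewrite !inE; case: (boolP (x \in M)) => //= xM.
by rewrite (covers_meet_le_join (lmM xM) cyz).
Qed.

Lemma low_antitone y z w w' : y <= w -> w' <= z -> low y z \subset low w w'.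
Proof.
move=> yw wz; apply/subsetP => x; rewrite !inE => /andP[-> /meet_leP h] /=.
apply/meet_leP => u ux uw; apply: le_trans yw; apply: h => //.
exact: le_trans wz.
Qed.

Lemma high_monotone y z w w' : y <= w -> w' <= z ->
  high w w' \subset high y z.
Proof.
move=> yw wz; apply/subsetP => x; rewrite !inE => /andP[-> h] /=.
apply: contra h => /le_joinP h; apply/le_joinP => u xu wu.
by apply: (le_trans wz); apply: h => //; apply: le_trans wu.
Qed.

(** Since $y < z$, [\top] is outside [low y z]; the least element of [M] outside it is the cut
    [q]. *)
Lemma low_min y z : y < z -> exists q,
  [/\ q \in M, ~~ meet_le q z y & low y z = [set x in M | x < q]].
Proof.
move=> yz; have An0 : M :\: low y z != set0.
  apply/set0Pn; exists \top; rewrite !inE top_chain andbT /=.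
  by apply/negP => /meet_leP/(_ z (lex1 _) (lexx _)); rewrite lt_geF.
have [q] := chain_min (subsetDl M _) An0.
rewrite !inE => /andP[+ qM] minq; rewrite qM /= => qzy; exists q; split=> //.
apply/setP => x; rewrite !inE; case: (boolP (x \in M)) => //= xM.
apply/idP/idP => [xzy|xq].
  rewrite comparable_ltNge ?chain_comparable //; apply: contra qzy => qx.
  apply/meet_leP => u uq uz; apply: (meet_leP _ _ _ xzy) => //.
  exact: le_trans qx.
apply/negPn/negP => xzy; have := minq x; rewrite !inE xM andbT /= => /(_ xzy).
by rewrite lt_geF.
Qed.

Lemma high_max y z : y < z -> exists p,
  [/\ p \in M, ~~ le_join z p y & high y z = [set x in M | x <= p]].
Proof.
move=> yz; have An0 : high y z != set0.
  apply/set0Pn; exists \bot; rewrite !inE bot_chain /=.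
  by apply/negP => /le_joinP/(_ y (le0x _) (lexx _)); rewrite lt_geF.
have sub : high y z \subset M by apply/subsetP => x; rewrite inE => /andP[].
have [p] := chain_max sub An0; rewrite inE => /andP[pM pzy] maxp.
exists p; split=> //; apply/setP => x; apply/idP/idP => [xh|].
  by rewrite inE (subsetP sub) ?maxp.
rewrite !inE => /andP[-> xp] /=; apply: contra pzy => /le_joinP h.
by apply/le_joinP => u pu yu; apply: h => //; apply: le_trans pu.
Qed.

Lemma modular_label_step y z : y < z -> exists u,
  [/\ covers y u, u <= z, modular_label y u = modular_label y z,
      modular_label y z < modular_label u z &
      forall w, covers y w -> w <= z ->
        modular_label y w = modular_label y z -> w = u].
Proof.
move=> ltyz; have yz := ltW ltyz; have [q [qM qzy lowE]] := low_min ltyz.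
have q0 : q != \bot.
  apply: contraNneq qzy => ->; apply/meet_leP => u u0 _.
  exact: le_trans u0 (le0x _).
have [p [pM cpq maxp]] := chain_pred qM q0.
have pzy : meet_le p z y.
  have : p \in low y z by rewrite lowE inE pM covers_lt.
  by rewrite inE => /andP[].
have [u [cyu uz qzu uqy maxu]] :=
  covers_projection (lmM pM) (lmM qM) cpq yz pzy qzy.
have yu := ltW (covers_lt cyu).
(* For $x \ge q$ one has $w \le q \vee y \le x \vee y$, so [x] is outside [high y w], which is
   [low y w] on a cover. *)
have low_eq w : covers y w -> w <= z -> le_join w q y -> low y w = low y z.
  move=> cyw wz wqy; apply/eqP; rewrite eq_sym eqEsubset low_antitone //= lowE.
  apply/subsetP => x; rewrite low_covers // !inE => /andP[xM] /=; rewrite xM /=.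
  apply: contraR; rewrite -comparable_leNgt ?chain_comparable // => qx.
  apply/le_joinP => t xt yt; apply: (le_joinP _ _ _ wqy) => //.
  exact: le_trans xt.
exists u; split=> //; first by rewrite /modular_label low_eq.
  (* [q] makes the inclusion strict, as $q \wedge z \le u$. This includes $u = z$, where [low z z]
     is all of [M]. *)
  apply: proper_card; apply/properP; split; first exact: low_antitone.
  by exists q; rewrite ?lowE !inE qM ?ltxx.
move=> w cyw wz [ew].
(* Equal labels force equal sets, so [q] is outside [high y w]; thus $w \le q \vee y$, and [u] is
   the greatest such element. *)
have qyw : q \notin low y w.
  suff -> : low y w = low y z by rewrite lowE inE ltxx andbF.
  by apply/esym/eqP; rewrite eqEcard low_antitone //= ew.
have wu : w <= u.
  apply: maxu; first by rewrite wz ltW ?covers_lt.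
  by move: qyw; rewrite low_covers // inE qM /= negbK.
by case: (covers_between cyu (ltW (covers_lt cyw)) wu) => // e;
  move: (covers_lt cyw); rewrite e ltxx.
Qed.

(** * Bounds on the labels along unrefinable chains *)

Lemma unrefinable_cons y z u c :
  unrefinable_chain y z (u :: c) = covers y u && unrefinable_chain u z c.
Proof. by rewrite /unrefinable_chain /= andbA. Qed.

Lemma unrefinable_nil y z : unrefinable_chain y z [::] = (y == z).
Proof. by []. Qed.

Lemma unrefinable_le y z c : unrefinable_chain y z c -> y <= z.
Proof.
elim: c y => [|u c IH] y; first by rewrite unrefinable_nil => /eqP->.
by rewrite unrefinable_cons => /andP[/covers_lt/ltW yu /IH]; apply: le_trans.
Qed.

Lemma unrefinable_refl z c : unrefinable_chain z z c -> c = [::].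
Proof.
case: c => // u c; rewrite unrefinable_cons => /andP[/covers_lt zu].
by move=> /unrefinable_le; rewrite lt_geF.
Qed.

Lemma label_bounds y z c : unrefinable_chain y z c ->
  {in labels modular_label y c,
    forall l, modular_label y z <= l <= high_label y z}.
Proof.
elim: c y => [|u c IH] y; first by move=> _ l.
rewrite unrefinable_cons => /andP[cyu uc] l.
have uz := unrefinable_le uc; have yu := ltW (covers_lt cyu).
rewrite inE => /predU1P[->|/(IH _ uc)/andP[lo hi]].
  rewrite [modular_label y z <= _]subset_leq_card ?low_antitone //=.
  by rewrite {1}/modular_label low_covers // [_ <= _]subset_leq_card
             ?high_monotone.
apply/andP; split.
  apply: le_trans lo; rewrite [_ <= _]subset_leq_card //.
  exact: low_antitone.
by apply: (le_trans hi); rewrite [_ <= _]subset_leq_card // high_monotone.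
Qed.

Lemma low_label_attained y z c : y < z -> unrefinable_chain y z c ->
  modular_label y z \in labels modular_label y c.
Proof.
move=> yz hc; have [q [qM qzy lowE]] := low_min yz.
suff /hasP[l hl /= le_l] : has (fun l => l <= modular_label y z) (labels modular_label y c).
  suff <- : l = modular_label y z by [].
  by apply: le_anti; rewrite le_l; case/andP: (label_bounds hc hl) => ->.
(* With the bound frozen as the number of $x < q$ in [M], the start of the chain may move up as long
   as $q \wedge z \le y$ fails. The step where it begins to hold has the wanted label. *)
rewrite /modular_label lowE -/modular_label.
elim: c y qzy hc {yz lowE} => [|u c IH] y qzy.
  rewrite unrefinable_nil => /eqP yz; case/negP: qzy.
  by apply/meet_leP => t _; rewrite yz.
rewrite unrefinable_cons => /andP[cyu uc] /=.
have [qzu|qzu] := boolP (meet_le q z u); last by rewrite IH ?orbT.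
apply/orP; left; apply: subset_leq_card; apply/subsetP => x.
rewrite !inE => /andP[xM xuy]; rewrite xM /=.
rewrite comparable_ltNge ?chain_comparable //; apply: contra qzy => qx.
apply/meet_leP => t tq tz; apply: (meet_leP _ _ _ xuy).
  exact: le_trans qx.
exact: (meet_leP _ _ _ qzu).
Qed.

Lemma high_label_attained y z c : y < z -> unrefinable_chain y z c ->
  high_label y z \in labels modular_label y c.
Proof.
move=> yz hc; have [p [pM pzy highE]] := high_max yz.
suff /hasP[l hl /= le_l] : has (fun l => high_label y z <= l) (labels modular_label y c).
  suff <- : l = high_label y z by [].
  by apply: le_anti; rewrite le_l andbT; case/andP: (label_bounds hc hl).
rewrite /high_label highE.
have : le_join y p y by apply/le_joinP.
(* The base [y] of the join stays fixed while [w] climbs the chain with $w \le p \vee y$. The step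
   leaving this region has every $x \le p$ of [M] in its [high] set. *)
elim: c {1 2 4}y hc => [|u c IH] w.
  by rewrite unrefinable_nil => /eqP->; rewrite (negPf pzy).
rewrite unrefinable_cons => /andP[cwu uc] /= wpy.
have [upy|upy] := boolP (le_join u p y); first by rewrite IH ?orbT.
apply/orP; left; rewrite /modular_label low_covers //.
apply: subset_leq_card; apply/subsetP => x.
rewrite !inE => /andP[xM xp]; rewrite xM /=.
apply: contra upy => /le_joinP h; apply/le_joinP => t pt yt; apply: h.
  exact: le_trans pt.
exact: (le_joinP _ _ _ wpy).
Qed.

(** * Increasing chains and the EL property *)

Lemma increasing_chain_exists y z : y <= z -> exists c,
  unrefinable_chain y z c /\ sorted <%O (labels modular_label y c).
Proof.
have [n] := ubnP #|[set t | (y <= t <= z)%O]|.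
elim: n y => // n IH y; rewrite ltnS => hn; rewrite le_eqVlt.
case/predU1P => [->|yz]; first by exists [::]; rewrite unrefinable_nil.
have [u [cyu uz eyu ltu _]] := modular_label_step yz.
have [|c [hc sc]] := IH u _ uz.
  apply: leq_trans hn; apply/proper_card/properP; split.
    apply/subsetP => t; rewrite !inE => /andP[ut ->]; rewrite andbT.
    exact: le_trans (ltW (covers_lt cyu)) ut.
  by exists y; rewrite !inE ?lexx ?(ltW yz) // lt_geF // covers_lt.
exists (u :: c); rewrite unrefinable_cons cyu; split=> //=.
(* Every later label is at least [modular_label u z], which exceeds the first label. *)
rewrite (path_sortedE lt_trans) sc andbT eyu; apply/allP => l.
by case/(label_bounds hc)/andP => + _; apply: lt_le_trans.
Qed.

(** The least label occurs somewhere on the chain, so a sorted chain starts with it. *)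
Lemma increasing_chain_cons y z u c :
  increasing_chain modular_label y z (u :: c) ->
  [/\ covers y u, modular_label y u = modular_label y z &
      increasing_chain modular_label u z c].
Proof.
case/andP => hc /= sl; have := hc; rewrite unrefinable_cons => /andP[cyu uc].
have uz := unrefinable_le uc.
split=> //; last by rewrite /increasing_chain uc (path_sorted sl).
have yz : y < z := lt_le_trans (covers_lt cyu) uz.
have /andP[lo _] := label_bounds hc (mem_head _ _).
apply: le_anti; rewrite lo andbT.
have := low_label_attained yz hc; rewrite inE => /predU1P[->//|].
by apply: (allP (order_path_min le_trans sl)).
Qed.

Lemma increasing_chain_lex y z c c' :
  increasing_chain modular_label y z c -> unrefinable_chain y z c' ->
  c' <> c ->
  lex_precedes (labels modular_label y c) (labels modular_label y c').
Proof.
elim: c y c' => [|u c IH] y c'.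
  by case/andP; rewrite unrefinable_nil => /eqP-> _ /unrefinable_refl.
move=> /increasing_chain_cons[cyu eyu uc].
have uz : u <= z by case/andP: uc => /unrefinable_le.
have yz : y < z := lt_le_trans (covers_lt cyu) uz.
case: c' => [|w c']; first by rewrite unrefinable_nil lt_eqF.
move=> hc' ne; have /andP[lo _] := label_bounds hc' (mem_head _ _).
move: hc'; rewrite unrefinable_cons => /andP[cyw wc'].
rewrite /lex_precedes /= ltxi_cons -eyu in lo *; rewrite lo /=.
apply/implyP => hi.
(* A tie means that both chains start with the least label, which only one cover carries. *)
have ew : w = u.
  have [v [_ _ _ _ uniq_v]] := modular_label_step yz.
  rewrite [u]uniq_v //; apply: uniq_v => //; first exact: unrefinable_le wc'.
  by rewrite -eyu; apply: le_anti; rewrite lo hi.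
by subst w; apply: IH => // ec; apply: ne; rewrite ec.
Qed.

Lemma increasing_chain_unique y z : y <= z ->
  exists c, unique (increasing_chain modular_label y z) c.
Proof.
move=> /increasing_chain_exists[c [hc sc]].
have ic : increasing_chain modular_label y z c.
  by rewrite /increasing_chain hc (sub_sorted _ sc) //; apply: ltW.
(* Two distinct increasing chains would each lexicographically precede the other. *)
exists c; split=> // c' ic'; apply/eqP; apply: contraT => /eqP ne.
have /andP[hc' _] := ic'.
have := increasing_chain_lex ic hc' (nesym ne).
have := increasing_chain_lex ic' hc ne.
by rewrite /lex_precedes => /lt_trans h /h; rewrite ltxx.
Qed.

Lemma modular_label_EL : EL_labelling modular_label.
Proof.
move=> y z /ltW/increasing_chain_unique[c uc]; exists c; split=> // c'.
by apply: increasing_chain_lex; case: uc.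
Qed.

(** * The interpolation property *)

Lemma path_le_last (l : int) s :
  path <=%O l s -> {in l :: s, forall t, t <= last l s}.
Proof.
elim: s l => [|l' s IH] l /=; first by move=> _ t; rewrite inE => /eqP->.
move=> /andP[ll' /IH h] t; rewrite inE => /predU1P[->|/h //].
by apply: le_trans ll' (h _ (mem_head _ _)).
Qed.

Lemma increasing_chain_last y z c : y < z ->
  increasing_chain modular_label y z c ->
  last 0%R (labels modular_label y c) = high_label y z.
Proof.
move=> yz /andP[hc]; have := high_label_attained yz hc.
have := label_bounds hc; case: (labels _ _ _) => //= l s bnd hin sl.
apply: le_anti; rewrite (path_le_last sl) //.
by case/andP: (bnd _ (mem_last l s)) => _ ->.
Qed.

Lemma modular_label_interpolating : interpolating modular_label.
Proof.
move=> y u z cyu cuz; have yz := lt_trans (covers_lt cyu) (covers_lt cuz).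
case: ltP => [|ba]; [by left | right].
have [c [hc sc]] := increasing_chain_exists (ltW yz).
have ic : increasing_chain modular_label y z c.
  by rewrite /increasing_chain hc (sub_sorted _ sc) //; apply: ltW.
have huz : unrefinable_chain y z [:: u; z].
  by rewrite !unrefinable_cons cyu cuz unrefinable_nil /=.
have /andP[loa hia] : modular_label y z <= modular_label y u <= high_label y z.
  by apply: (label_bounds huz); rewrite inE eqxx.
have /andP[lob hib] : modular_label y z <= modular_label u z <= high_label y z.
  by apply: (label_bounds huz); rewrite !inE eqxx orbT.
(* Both bounds occur among the two labels of $y, u, z$; since these do not increase strictly, the
   lower bound is the second label and the upper bound the first. *)
exists c; split=> //.
  case: c hc ic {sc} => [|w c] hc ic.
    by move: hc; rewrite unrefinable_nil lt_eqF.
  have [_ /= -> _] := increasing_chain_cons ic; apply: le_anti; rewrite lob /=.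
  by have := low_label_attained yz huz; rewrite !inE => /pred2P[->|->].
rewrite (increasing_chain_last yz ic); apply: le_anti; rewrite hia andbT.
by have := high_label_attained yz huz; rewrite !inE => /pred2P[->|->].
Qed.

(** * The increasing maximal chain is [M] *)

Lemma chain_increasing y c : y \in M ->
  increasing_chain modular_label y \top c ->
  forall x, (x \in y :: c) = (x \in M) && (y <= x).
Proof.
elim: c y => [|u c IH] y yM.
  case/andP; rewrite unrefinable_nil => /eqP-> _ x; rewrite inE.
  by rewrite le1x; case: eqP => [->|]; rewrite ?top_chain ?andbF.
move=> /increasing_chain_cons[cyu eyu uc].
have yt : y < \top := lt_le_trans (covers_lt cyu) (lex1 _).
(* Here [low y \top] consists of the $x \le y$ in [M], so [q] is the next element of [M] above
   [y]. *)
have [q [qM qty lowE]] := low_min yt.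
have yq : y < q.
  rewrite comparable_ltNge ?chain_comparable //; apply: contra qty => qy.
  by apply/meet_leP => t tq _; apply: le_trans qy.
(* The least label keeps [q] out of [high y u], so $u \le q \vee y = q$. *)
have uq : u <= q.
  have : q \notin low y u.
    have -> : low y u = low y \top.
      apply/esym/eqP; rewrite eqEcard low_antitone ?lex1 //=.
      by case: eyu => ->.
    by rewrite lowE inE ltxx andbF.
  rewrite low_covers // inE qM /= negbK => /le_joinP; apply=> //.
  exact: ltW.
have minq x : x \in M -> y < x -> q <= x.
  move=> xM yx; rewrite comparable_leNgt ?chain_comparable //.
  apply/negP => xq; have : x \in low y \top by rewrite lowE inE xM.
  rewrite inE => /andP[_ /meet_leP/(_ x (lexx _) (lex1 _))].
  by rewrite lt_geF.
(* As $y < u \le q$ and [M] has nothing strictly between [y] and [q], [u] is comparable to all of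
   [M]. *)
have uM : u \in M.
  apply: mem_maximal_chain => x xM.
  have /orP[|yx] := chain_comparable xM yM.
    move=> xy; apply: ge_comparable.
    exact: le_trans xy (ltW (covers_lt cyu)).
  move: yx; rewrite le_eqVlt => /predU1P[<-|yx].
    exact/gt_comparable/covers_lt.
  by apply: le_comparable; apply: le_trans uq (minq _ xM yx).
move=> x; rewrite inE IH //; case: (eqVneq x y) => [->|nxy] /=.
  by rewrite yM lexx.
case: (boolP (x \in M)) => //= xM.
apply/idP/idP => [|yx]; first exact/le_trans/ltW/covers_lt.
by apply: le_trans uq (minq _ xM _); rewrite lt_neqAle eq_sym nxy.
Qed.

End Labelling.

Theorem theorem2 (d : Order.disp_t) (P : finTBPOrderType d) (M : {set P})
    (hM : maximal_chain M) (hlm : forall x : P, x \in M -> left_modular x) :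
  exists gamma : edge_labelling P,
    [/\ EL_labelling gamma,
        interpolating gamma &
        exists c : seq P,
          unique (increasing_chain gamma \bot \top) c /\
          M = [set:: \bot :: c]].
Proof.
exists (modular_label M); split.
- exact: modular_label_EL.
- exact: modular_label_interpolating.
have [c uc] := increasing_chain_unique hM hlm (le0x \top); exists c.
split=> //; apply/setP => x; rewrite [RHS]inE.
by rewrite (chain_increasing hM hlm (bot_chain hM) (proj1 uc)) le0x andbT.
Qed.
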